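(* Let $n,p\ge1$ be integers, $\mathbf X\in\mathbb{R}^{n\times p}$ a deterministic matrix, $\boldsymbol\beta^\star\in\mathbb{R}^p$, and $\boldsymbol y=\mathbf X\boldsymbol\beta^\star+\boldsymbol\xi$ with $\boldsymbol\xi\sim\mathcal N(0,\sigma^2\mathbf I_n)$, $\sigma>0$. Let $\lambda>0$ and $\tau>0$. Then $$\widehat R^{\rm EWA}(\lambda,\tau)=\frac1n\|\boldsymbol y-\mathbf X\widehat{\boldsymbol\beta}^{\rm EWA}\|_2^2-\sigma^2+\frac{2\sigma^2}{n^2\tau}\int_{\mathbb{R}^p}\|\mathbf X(\boldsymbol\beta-\widehat{\boldsymbol\beta}^{\rm EWA})\|_2^2\,\hat\pi_n(\boldsymbol\beta)\,d\boldsymbol\beta$$ is an unbiased estimator of the risk of $\widehat{\boldsymbol\beta}^{\rm EWA}$, i.e. $$\mathbb{E}\big[\widehat R^{\rm EWA}(\lambda,\tau)\big]=\mathbb{E}\big[\ell_n(\widehat{\boldsymbol\beta}^{\rm EWA},\boldsymbol\beta^\star)\big].$$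
   Context: $\boldsymbol x_1,\dots,\boldsymbol x_n\in\mathbb{R}^p$ are the rows of $\mathbf X$. Prediction loss: $\ell_n(\boldsymbol\beta,\boldsymbol\beta')=\frac1n\|\mathbf X(\boldsymbol\beta-\boldsymbol\beta')\|_2^2$. The potential is $V_n(\boldsymbol\beta)=\frac{1}{2n}\sum_{i=1}^n(y_i-\boldsymbol{x}_i^\top\boldsymbol\beta)^2+\lambda\|\boldsymbol\beta\|_1$; the pseudo-posterior is the probability density on $\mathbb{R}^p$ with $\hat\pi_n(\boldsymbol\beta)\propto\exp(-V_n(\boldsymbol\beta)/\tau)$; and $\widehat{\boldsymbol\beta}^{\rm EWA}=\int_{\mathbb{R}^p}\boldsymbol\beta\,\hat\pi_n(\boldsymbol\beta)\,d\boldsymbol\beta$ (both depend on $\boldsymbol y,\lambda,\tau$). *)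

(* Defs.v *)
From HB Require Import structures.
From mathcomp Require Import all_boot all_order all_algebra.
From mathcomp Require Import all_classical all_reals all_analysis.
From mathcomp Require Import measurable_realfun.

Set Implicit Arguments.
Unset Strict Implicit.
Unset Printing Implicit Defensive.

Import Order.TTheory GRing.Theory Num.Theory.
Import numFieldNormedType.Exports.

Local Open Scope classical_set_scope.
Local Open Scope ring_scope.

(* The library equips n.-tuple R with the product sigma-algebra but provides  *)
(* no Lebesgue measure there: it is built here as the n-fold product of the   *)
(* Lebesgue measure of the line, transported along R * R^n = R^(n+1).         *)
Section lebesgue_tuple.
Variable R : realType.

Definition tuple_cons n (x : measurableTypeR R * n.-tuple R) : n.+1.-tuple R :=
  [tuple of x.1 :: x.2].

Definition tuple_uncons n (x : n.+1.-tuple R) : measurableTypeR R * n.-tuple R :=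
  (thead x, [tuple of behead x]).

Lemma tuple_consK n : cancel (@tuple_cons n) (@tuple_uncons n).
Proof. by case=> a x; congr (_, _); exact: val_inj. Qed.

Lemma tuple_unconsK n : cancel (@tuple_uncons n) (@tuple_cons n).
Proof. by move=> x; rewrite [RHS]tuple_eta. Qed.

Lemma measurable_tuple_cons n : measurable_fun [set: _] (@tuple_cons n).
Proof. exact: measurable_cons. Qed.

Lemma measurable_tuple_uncons n : measurable_fun [set: _] (@tuple_uncons n).
Proof.
apply/measurable_fun_pairP; split; first exact: measurable_tnth.
exact: measurable_behead.
Qed.

Fixpoint lebesgue_tuple n : set (n.-tuple R) -> \bar R :=
  match n with
  | 0 => \d_[tuple]
  | n'.+1 =>
    pushforward (lebesgue_measure \x @lebesgue_tuple n')%E (@tuple_cons n')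
  end.

Section lebesgue_tuple_step.
Variables (n : nat) (mu : {sigma_finite_measure set (n.-tuple R) -> \bar R}).

Let nu := pushforward (lebesgue_measure \x mu)%E (@tuple_cons n).

Let nu0 : nu set0 = 0%E.
Proof. by rewrite /nu /pushforward preimage_set0 measure0. Qed.

Let nu_ge0 A : (0 <= nu A)%E.
Proof. by rewrite /nu /pushforward measure_ge0. Qed.

Let mpreimage (A : set (n.+1.-tuple R)) :
  measurable A -> measurable (@tuple_cons n @^-1` A).
Proof.
by move=> mA; rewrite -[X in measurable X]setTI; exact: measurable_tuple_cons.
Qed.

Let nu_sigma_additive : semi_sigma_additive nu.
Proof.
move=> F mF tF mUF; rewrite /nu /pushforward preimage_bigcup.
apply: measure_semi_sigma_additive.
- by move=> k; exact: mpreimage.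
- apply/trivIsetP => /= i j _ _ ij; rewrite -preimage_setI.
  by move/trivIsetP : tF => /(_ _ _ _ _ ij) ->//; rewrite preimage_set0.
- by rewrite -preimage_bigcup; exact: mpreimage.
Qed.

Let nu_sigma_finite : sigma_finite setT nu.
Proof.
have /sigma_finiteP[F [TF ndF Foo]] := sigma_finiteT (@lebesgue_measure R).
have /sigma_finiteP[G [TG ndG Goo]] := sigma_finiteT mu.
exists (fun k => @tuple_uncons n @^-1` (F k `*` G k)).
  rewrite -preimage_bigcup (_ : \bigcup_k _ = setT) ?preimage_setT//.
  rewrite -setXTT TF TG predeqE => -[x y]; split; last first.
    by move=> [/= [i _ Fix] [j _ Gjy]]; exists (maxn i j) => //; split;
      [move: x Fix; exact/subsetPset/ndF/leq_maxl
      |move: y Gjy; exact/subsetPset/ndG/leq_maxr].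
  by move=> [i _ []/= ? ?]; split; exists i.
move=> k; have [mF Foo_k] := Foo k; have [mG Goo_k] := Goo k; split.
  rewrite -[X in measurable X]setTI.
  by apply: measurable_tuple_uncons => //; exact: measurableX.
rewrite /nu /pushforward -comp_preimage.
rewrite (_ : _ \o _ = id) ?preimage_id; last first.
  by apply/funext => x /=; rewrite tuple_consK.
by rewrite product_measure1E// lte_mul_pinfty// ge0_fin_numE.
Qed.

Lemma lebesgue_tuple_step :
  exists nu' : {sigma_finite_measure set (n.+1.-tuple R) -> \bar R},
    nu = nu' :> (set _ -> \bar R).
Proof.
pose nu_measure := isMeasure.Build _ _ _ nu nu0 nu_ge0 nu_sigma_additive.
pose nu_M : {measure set (n.+1.-tuple R) -> \bar R} := HB.pack nu nu_measure.
pose nu_sf := Measure_isSigmaFinite.Build _ _ _ nu_M nu_sigma_finite.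
pose nu_S : {sigma_finite_measure set (n.+1.-tuple R) -> \bar R} :=
  HB.pack nu nu_measure nu_sf.
by exists nu_S.
Qed.

End lebesgue_tuple_step.

Lemma lebesgue_tuple_sigma_finite_measure n :
  exists mu : {sigma_finite_measure set (n.-tuple R) -> \bar R},
    @lebesgue_tuple n = mu :> (set _ -> \bar R).
Proof.
elim: n => [|n [mu /= ->]]; last exact: lebesgue_tuple_step.
by exists (\d_[tuple]).
Qed.

Section lebesgue_tuple_instances.
Variable n : nat.

Let leb0 : @lebesgue_tuple n set0 = 0%E.
Proof.
by have [mu ->] := lebesgue_tuple_sigma_finite_measure n; rewrite measure0.
Qed.

Let leb_ge0 A : (0 <= @lebesgue_tuple n A)%E.
Proof.
by have [mu ->] := lebesgue_tuple_sigma_finite_measure n; exact: measure_ge0.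
Qed.

Let leb_sigma_additive : semi_sigma_additive (@lebesgue_tuple n).
Proof.
have [mu ->] := lebesgue_tuple_sigma_finite_measure n.
exact: measure_semi_sigma_additive.
Qed.

HB.instance Definition _ := isMeasure.Build _ _ _ (@lebesgue_tuple n)
  leb0 leb_ge0 leb_sigma_additive.

Let leb_sigma_finite : sigma_finite setT (@lebesgue_tuple n).
Proof.
have [mu ->] := lebesgue_tuple_sigma_finite_measure n.
exact: sigma_finiteT.
Qed.

HB.instance Definition _ := Measure_isSigmaFinite.Build _ _ _
  (@lebesgue_tuple n) leb_sigma_finite.

End lebesgue_tuple_instances.

Lemma lebesgue_tuple_box n (A : 'I_n -> set R) :
  (forall i, measurable (A i)) ->
  lebesgue_tuple [set x : n.-tuple R | forall i, A i (tnth x i)] =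
  (\prod_(i < n) lebesgue_measure (A i))%E.
Proof.
elim: n A => [|n ih] A mA.
  by rewrite big_ord0 /= diracE mem_set//= => -[].
rewrite big_ord_recl -(ih (fun i => A (lift ord0 i)))//= /pushforward.
set B := [set x : n.-tuple R | _].
have mB : measurable B.
  rewrite (_ : B = \bigcap_i ((@tnth n R ^~ i) @^-1` A (lift ord0 i))).
    apply: fin_bigcap_measurable => // i _.
    by rewrite -[X in measurable X]setTI; exact: measurable_tnth.
  by apply/seteqP; split => [x xA i _|x xA i]; exact: xA.
have <- := @product_measure1E _ _ _ _ _ (@lebesgue_measure R)
  (@lebesgue_tuple n) _ _ (mA ord0) mB.
congr (product_measure1 _ _ _).
apply/seteqP; split => [[a x] /= H|[a x] /= [Ha Hx] i].
  by split=> [|i]; [exact: (H ord0)|have := H (lift ord0 i); rewrite tnthS].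
by case: (unliftP ord0 i) => [j ->|->//]; rewrite tnthS.
Qed.

End lebesgue_tuple.

Definition col_of_tuple (R : Type) n (x : n.-tuple R) : 'cV[R]_n :=
  \col_i tnth x i.

Definition sqnorm2 (R : realType) n (v : 'cV[R]_n) : R := \sum_i v i 0 ^+ 2.

Definition norm1 (R : realType) n (v : 'cV[R]_n) : R := \sum_i `|v i 0|.

(* Density of N(m, S) for a positive definite covariance matrix S.            *)
Definition gaussian_pdf (R : realType) n (m : 'cV[R]_n) (S : 'M[R]_n)
    (z : 'cV[R]_n) : R :=
  (Num.sqrt (\det ((2 * pi) *: S)))^-1 *
  expR (- ((z - m)^T *m invmx S *m (z - m)) 0 0 / 2).

Definition gaussian_vector d (Omega : measurableType d) (R : realType)
    (P : probability Omega R) n (xi : {RV P >-> n.-tuple R})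
    (m : 'cV[R]_n) (S : 'M[R]_n) : Prop :=
  forall A : set (n.-tuple R), measurable A ->
    distribution P xi A =
    (\int[@lebesgue_tuple R n]_(z in A)
       (gaussian_pdf m S (col_of_tuple z))%:E)%E.

Section ewa.
Variables (R : realType) (n p : nat) (X : 'M[R]_(n, p)).
Implicit Types (b : 'cV[R]_p) (y : 'cV[R]_n) (lambda tau sigma : R).

Definition prediction_loss b b' : R := n%:R^-1 * sqnorm2 (X *m (b - b')).

Definition potential lambda y b : R :=
  (2 * n%:R)^-1 * (\sum_i (y i 0 - (row i X *m b) 0 0) ^+ 2)
  + lambda * norm1 b.

Definition pseudo_posterior lambda tau y b : R :=
  expR (- potential lambda y b / tau) /
  \int[@lebesgue_tuple R p]_t
    expR (- potential lambda y (col_of_tuple t) / tau).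

Definition ewa lambda tau y : 'cV[R]_p :=
  \col_j \int[@lebesgue_tuple R p]_t
    (tnth t j * pseudo_posterior lambda tau y (col_of_tuple t)).

Definition ewa_risk_estimator sigma lambda tau y : R :=
  n%:R^-1 * sqnorm2 (y - X *m ewa lambda tau y) - sigma ^+ 2
  + 2 * sigma ^+ 2 / (n%:R ^+ 2 * tau) *
    \int[@lebesgue_tuple R p]_t
      (sqnorm2 (X *m (col_of_tuple t - ewa lambda tau y))
       * pseudo_posterior lambda tau y (col_of_tuple t)).

End ewa.

(* Main.v *)
(* With y = m + xi, the fit f(y) = X ewa(y) has partial derivatives
   df_i/dy_i = Var((X b)_i) / (n tau), variances being taken under the
   pseudo-posterior, by differentiation under the integral sign.  Hence
   risk_hat - loss is the mean over i of xi_i h_i - sigma^2 dh_i/dy_i with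
   h_i = xi_i - 2 (f_i - m_i), and each term has zero expectation by Stein's
   identity, i.e. by Gaussian integration by parts along the i-th coordinate.
   Integrability holds because posterior moments grow at most polynomially
   in y. *)
Require Import Defs.
From HB Require Import structures.
From mathcomp Require Import all_boot all_order all_algebra.
From mathcomp Require Import all_classical all_reals all_analysis.
From mathcomp Require Import measurable_realfun.
From mathcomp Require Import ring lra.

Set Implicit Arguments.
Unset Strict Implicit.
Unset Printing Implicit Defensive.

Import Order.TTheory GRing.Theory Num.Theory.
Import numFieldNormedType.Exports.

Local Open Scope classical_set_scope.
Local Open Scope ring_scope.

(** * Integration against a density *)

(** The delicate point is integrability. The normaliser of the posterior may be as small as a
    multiple of e^{-a} with a = |y|^2 / (n tau), so bounding numerator and denominator of a
    posterior mean separately leaves a factor e^{a}, which the Gaussian density cannot absorb when n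
    tau <= 2 sigma^2. Instead, a polynomial in |t|_1 is bounded by a polynomial in a times 1 +
    e^{delta |t|_1 - a}; the extra e^{-a} compensates the small normaliser. The decay in t comes
    from the l1 penalty alone, uniformly in y and whatever the rank of [X]; the same decay dominates
    the differentiated integrals. The loss and the terms of Stein's identity are then [tempered]
    functions of the noise, a class closed under sums and products and integrable against a
    Gaussian. Stein's identity is read off the density: the weighted integrand is a derivative along
    one coordinate, so it integrates to 0 on every line in that direction, and Fubini concludes. *)

Section density.
Context d (T : measurableType d) (R : realType).
Variables (mu nu : {measure set T -> \bar R}) (g : T -> R).
Hypotheses (mg : measurable_fun setT g) (g0 : forall x, 0 <= g x).
Hypothesis nuE : forall A, measurable A -> nu A = (\int[mu]_(x in A) (g x)%:E)%E.
Local Open Scope ereal_scope.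

Import HBNNSimple.

(** [nuE] is the case of indicators; simple functions follow by linearity, and both sides pass to
    the limit by monotone convergence. *)
Lemma ge0_integral_density (f : T -> \bar R) : (forall x, 0 <= f x) ->
  measurable_fun setT f -> \int[nu]_x f x = \int[mu]_x (f x * (g x)%:E).
Proof.
move=> f0 mf.
have mEg : measurable_fun setT (EFin \o g) by exact/measurable_EFinP.
pose h := nnsfun_approx measurableT mf.
have -> : \int[nu]_x f x = lim (\int[nu]_x (EFin \o h n) x @[n --> \oo]).
  have fE x : f x = lim ((EFin \o h n) x @[n --> \oo]).
    by apply/esym/cvg_lim => //; exact: cvg_nnsfun_approx.
  under eq_integral do rewrite fE.
  apply: monotone_convergence => //.
  - by move=> n; exact/measurable_EFinP.
  - by move=> n x _ /=; rewrite lee_fin.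
  - by move=> x _ a b ab; rewrite lee_fin; exact/lefP/nd_nnsfun_approx.
have -> : \int[mu]_x (f x * (g x)%:E) =
    lim (\int[mu]_x ((h n x)%:E * (g x)%:E) @[n --> \oo]).
  have fg x : f x * (g x)%:E = lim (((h n x)%:E * (g x)%:E) @[n --> \oo]).
    apply/esym/cvg_lim => //; apply: cvgeZr => //.
    exact: cvg_nnsfun_approx.
  under eq_integral do rewrite fg.
  apply: monotone_convergence => [//| | |].
  - by move=> n; apply/emeasurable_funM => //; exact/measurable_EFinP.
  - by move=> n x _ /=; rewrite mule_ge0 ?lee_fin.
  - move=> x _ a b ab/=; rewrite lee_wpmul2r ?lee_fin//.
    exact/lefP/nd_nnsfun_approx.
suff suf n : \int[mu]_x ((h n x)%:E * (g x)%:E) = \int[nu]_x (EFin \o h n) x.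
  by congr (lim (_ @ \oo)); apply/funext => n.
transitivity (\int[nu]_x
   (\sum_(y \in range (h n)) (y * \1_(h n @^-1` [set y]) x)%:E)); last first.
  by apply: eq_integral => t tE; rewrite /= fimfunE -fsumEFin.
have indich m r : measurable_fun setT (fun x => (r * \1_(h m @^-1` [set r]) x)%:E).
  by apply: (measurable_comp measurableT) => //; exact: measurable_funM.
rewrite ge0_integral_fsum//; last by move=> m y Ey; exact: nnfun_muleindic_ge0.
transitivity (\int[mu]_x (\sum_(y \in range (h n))
    (y * \1_(h n @^-1` [set y]) x)%:E * (g x)%:E)).
  under [RHS]eq_integral => x xE.
    rewrite -ge0_mule_fsuml => [|y]; last exact: nnfun_muleindic_ge0.
    rewrite fsumEFin // -(fimfunE _ x); over.
  by [].
rewrite ge0_integral_fsum//; last 2 first.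
  - by move=> y; apply: emeasurable_funM.
  - by move=> m y Ey; apply: mule_ge0; [exact: nnfun_muleindic_ge0|rewrite lee_fin].
apply: eq_fsbigr => r rhn.
under [RHS]eq_integral do rewrite EFinM.
rewrite integralZl_indic_nnsfun => //.
under eq_integral do rewrite EFinM -muleA.
have mhr : measurable (h n @^-1` [set r]) by exact: measurable_sfunP.
(* Scalars leave an integral only when nonnegative; for [r < 0] the level set of the nonnegative
   [h n] is empty and both sides vanish. *)
case: (ltP r 0%R) => [r0|r0].
  rewrite preimage_nnfun0// indic0 !integral0_eq ?mule0//.
  by move=> x _; rewrite mul0e mule0.
rewrite ge0_integralZl//.
- under eq_integral do rewrite muleC.
  rewrite (eq_integral ((EFin \o g) \_ (h n @^-1` [set r]))); last first.
    by move=> x xE; rewrite epatch_indic.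
  by rewrite -integral_mkcond -nuE// integral_indic// setIT.
- by apply: emeasurable_funM => //; exact/measurable_EFinP.
- by move=> x _; rewrite mule_ge0// lee_fin.
Qed.

Lemma integrable_density (f : T -> R) : measurable_fun setT f ->
  mu.-integrable setT (fun x => (f x * g x)%:E) <->
  nu.-integrable setT (EFin \o f).
Proof.
move=> mf.
have E : \int[nu]_x `|(f x)%:E| = \int[mu]_x `|(f x * g x)%:E|.
  rewrite ge0_integral_density//; last first.
    by apply/measurableT_comp => //; exact/measurable_EFinP.
  by apply: eq_integral => x _; 
    rewrite EFinM abseM (gee0_abs (x := (g x)%:E)) ?lee_fin.
split=> /integrableP[_]; rewrite ?E => foo; apply/integrableP; split => //.
- exact/measurable_EFinP.
- by rewrite /= E.
- by apply/measurable_EFinP; exact: measurable_funM.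
Qed.

Lemma integral_density (f : T -> R) : measurable_fun setT f ->
  \int[nu]_x (f x)%:E = \int[mu]_x (f x * g x)%:E.
Proof.
move=> mf.
have mEf : measurable_fun setT (EFin \o f) by exact/measurable_EFinP.
rewrite integralE [RHS]integralE.
rewrite !ge0_integral_density//; [|exact: measurable_funeneg|exact: measurable_funepos].
congr (_ - _); apply: eq_integral => x _.
  by rewrite !funeposE EFinM maxe_pMl ?lee_fin// mul0e.
by rewrite !funenegE EFinM -mulNe maxe_pMl ?lee_fin// mul0e.
Qed.

End density.

(** * Lebesgue measure on the line and on tuples *)

Section line.
Context (R : realType).
Notation mu := (@lebesgue_measure R).

(** By evenness only the half-line matters, and there the function is 1/c times the density of the
    exponential law. *)
Lemma integrable_expR_normr (c : R) : 0 < c ->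
  mu.-integrable setT (fun x : R => (expR (- (c * `|x|)))%:E).
Proof.
move=> c0.
have cf : continuous (fun x : R => expR (- (c * `|x|))).
  move=> x; apply: continuous_comp; last exact: continuous_expR.
  apply: (@continuousN _ R^o); apply: (@continuousM _ R^o (cst c)).
    exact: cst_continuous.
  exact: norm_continuous.
apply/integrableP; split.
  by apply/measurable_EFinP; exact: continuous_measurable_fun.
under eq_integral do rewrite /= ger0_norm ?expR_ge0//.
rewrite ge0_symfun_integralT//; last first.
  by move=> x /=; rewrite normrN.
rewrite -ge0_fin_numE; last first.
  by rewrite mule_ge0// integral_ge0// => x _; rewrite lee_fin expR_ge0.
rewrite fin_numM// ge0_fin_numE; last first.
  by rewrite integral_ge0// => x _; rewrite lee_fin expR_ge0.
rewrite -set_itvcy.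
rewrite (eq_integral (fun x : measurableTypeR R =>
  (c^-1)%:E * (exponential_pdf c x)%:E)%E); last first.
  move=> x; rewrite inE/= in_itv/= andbT => x0.
  rewrite exponential_pdfE// -EFinM ger0_norm// mulrA mulVf ?gt_eqF// mul1r.
  by rewrite mulNr.
have iexp : mu.-integrable `[0, +oo[%classic (EFin \o exponential_pdf c).
  apply: integrableS (integrable_exponential_pdf c0) => //.
rewrite -ge0_fin_numE; last first.
  apply: integral_ge0 => x _.
  by rewrite -EFinM lee_fin mulr_ge0 ?invr_ge0 ?exponential_pdf_ge0// ltW.
exact: integrable_fin_num (integrableZl _ c^-1 iexp).
Qed.

(* The primitive vanishes at both ends, being dominated by e^{-c|s|}. *)
Lemma integral_derive_eq0 (F G : R -> R) (c K : R) : 0 < c ->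
  (forall s : R, is_derive s (1 : R) F (G s)) -> continuous G ->
  (forall s, `|F s| <= K * expR (- (c * `|s|))) ->
  (forall s, `|G s| <= K * expR (- (c * `|s|))) ->
  (\int[mu]_s (G s)%:E = 0)%E.
Proof.
move=> c0 dF cG bF bG.
have K0 : 0 <= K by have := le_trans (normr_ge0 _) (bF 0); rewrite pmulr_lge0 ?expR_gt0.
have cF : continuous F.
  by move=> s; apply/differentiable_continuous/derivable1_diffP; exact: ex_derive.
have mG : measurable_fun [set: measurableTypeR R] G by exact: continuous_measurable_fun.
(* The successor keeps the interval nondegenerate at [n = 0], as the fundamental theorem of calculus
   demands. *)
pose I n := `[- n.+1%:R, n.+1%:R]%classic : set R.
pose f_ n := (EFin \o G) \_ (I n).
have dom : mu.-integrable setT (fun s => (K * expR (- (c * `|s|)))%:E).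
  under [X in integrable _ _ X]funext do rewrite EFinM.
  by apply: integrableZl => //; exact: integrable_expR_normr.
have [||||_ _] := @dominated_convergence _ _ _ mu setT measurableT f_
  (EFin \o G) _ _ _ _ dom _.
- move=> n; apply/measurable_restrict => //; first exact: measurable_itv.
  apply: measurable_funTS.
  exact/measurable_EFinP.
- exact/measurable_EFinP.
- apply/aeW => s _; apply: cvg_near_cst; near=> n.
  rewrite /f_ patchE mem_set//; rewrite /I/= in_itv/= -ler_norml.
  rewrite (le_trans (ltW (truncnS_gt _)))// ler_nat ltnS.
  by near: n; exact: nbhs_infty_ge.
- apply/aeW => s n _; rewrite /f_ patchE; case: ifPn => _.
    by rewrite lee_fin.
  by rewrite abse0 lee_fin mulr_ge0// expR_ge0.
move=> cvI.
have E n : (\int[mu]_x f_ n x = (F n.+1%:R - F (- n.+1%:R))%:E)%E.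
  rewrite /f_ -integral_mkcond (@continuous_FTC2 _ G F)//.
  - by rewrite -subr_gt0 opprK addr_gt0.
  - exact: continuous_subspaceT.
  - split => [x _||].
    + exact: ex_derive.
    + exact/cvg_at_right_filter/cF.
    + exact/cvg_at_left_filter/cF.
  - by move=> x _; rewrite derive1E; apply: derive_val.
have e0 : expR (- (c * n%:R)) @[n --> \oo] --> (0 : R).
  apply: (@cvg_comp _ _ _ (fun n => n%:R) (fun x => expR (- (c * x))) _
    (pinfty_nbhs R)); first exact: cvgr_idn.
  apply: (@cvg_comp _ _ _ (fun x => c * x) (fun x => expR (- x)) _
    (pinfty_nbhs R)); last exact: cvgr_expR.
  exact: gt0_cvgMry.
have b0 : (2 * K) * expR (- (c * n%:R)) @[n --> \oo] --> (0 : R).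
  by rewrite -[X in _ --> X](mulr0 (2 * K)); apply: cvgMr.
have u0 : F n.+1%:R - F (- n.+1%:R) @[n --> \oo] --> (0 : R).
  apply: (@squeeze_cvgr _ _ _ _ (fun n => - ((2 * K) * expR (- (c * n%:R))))
    (fun n => (2 * K) * expR (- (c * n%:R)))) => //; last first.
    by rewrite -[X in _ --> X]oppr0; exact: cvgN.
  apply: nearW => n; rewrite -ler_norml (le_trans (ler_normB _ _))//.
  rewrite -mulrA mulr_natl mulr2n lerD// (le_trans (bF _))// ler_wpM2l//.
    by rewrite ler_expR lerN2 ler_wpM2l ?(ltW c0)// ger0_norm// ler_nat.
  by rewrite ler_expR lerN2 ler_wpM2l ?(ltW c0)// normrN ger0_norm// ler_nat.
rewrite -(cvg_lim _ cvI)//; apply/cvg_lim => //.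
under eq_fun do rewrite E.
by apply: cvg_EFin => //; exact: nearW.
Unshelve. all: by end_near.
Qed.

End line.

(** * Integration over tuples, one coordinate at a time *)

Section tuple_space.
Context (R : realType).
Notation mu := (@lebesgue_measure R).
Notation L n := (@lebesgue_tuple R n).

(** The l1 norm measures all growth and decay: its exponential factors over the coordinates, and it
    is the norm of the penalty. *)
Definition norm1_tuple n (z : n.-tuple R) : R := \sum_i `|tnth z i|.

Definition update_tuple n (z : n.-tuple R) (i : 'I_n) (s : R) : n.-tuple R :=
  [tuple (if j == i then s else tnth z j) | j < n].

Lemma norm1_tuple_ge0 n (z : n.-tuple R) : 0 <= norm1_tuple z.
Proof. exact: sumr_ge0. Qed.

Lemma norm1_tuple_cons n (x : R) (z : n.-tuple R) :
  norm1_tuple (tuple_cons (x, z)) = `|x| + norm1_tuple z.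
Proof.
rewrite /norm1_tuple big_ord_recl; congr (_ + _).
by apply: eq_bigr => i _; rewrite tnthS.
Qed.

Lemma update_tuple_cons0 n (x s : R) (z : n.-tuple R) :
  update_tuple (tuple_cons (x, z)) ord0 s = tuple_cons (s, z).
Proof.
apply: eq_from_tnth => i; rewrite tnth_mktuple.
by case: (unliftP ord0 i) => [j ->|->]//=; rewrite !tnthS.
Qed.

Lemma update_tuple_consS n (x s : R) (z : n.-tuple R) (i : 'I_n) :
  update_tuple (tuple_cons (x, z)) (lift ord0 i) s
  = tuple_cons (x, update_tuple z i s).
Proof.
apply: eq_from_tnth => j; rewrite tnth_mktuple.
case: (unliftP ord0 j) => [k ->|->]//=.
by rewrite !tnthS (inj_eq lift_inj) tnth_mktuple.
Qed.

Lemma measurable_norm1_tuple n : measurable_fun [set: n.-tuple R] (@norm1_tuple n).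
Proof.
apply: measurable_sum => i.
exact: (measurableT_comp (@normr_measurable R setT) (measurable_tnth i)).
Qed.

Lemma ge0_integral_lebesgue_tupleS n (f : n.+1.-tuple R -> \bar R) :
  measurable_fun setT f -> (forall z, 0 <= f z)%E ->
  (\int[L n.+1]_z f z = \int[mu]_x \int[L n]_z f (tuple_cons (x, z)))%E.
Proof.
move=> mf f0.
rewrite [LHS](ge0_integral_pushforward (@measurable_tuple_cons R n)
  (product_measure1 mu (L n)))//.
rewrite preimage_setT fubini_tonelli1//; last by move=> z; exact: f0.
by apply: measurableT_comp => //; exact: measurable_tuple_cons.
Qed.

Lemma integrable_lebesgue_tupleS n (f : n.+1.-tuple R -> \bar R) :
  (L n.+1).-integrable setT f ->
  (product_measure1 mu (L n)).-integrable setT (f \o @tuple_cons R n).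
Proof.
move=> /integrableP[mf foo]; apply/integrableP; split.
  by apply: measurableT_comp => //; exact: measurable_tuple_cons.
move: foo; rewrite (ge0_integral_pushforward (@measurable_tuple_cons R n)
  (product_measure1 mu (L n)))//.
exact: measurableT_comp.
Qed.

Lemma integral_lebesgue_tupleS n (f : n.+1.-tuple R -> \bar R) :
  (L n.+1).-integrable setT f ->
  (\int[L n.+1]_z f z = \int[mu]_x \int[L n]_z f (tuple_cons (x, z)))%E.
Proof.
move=> fi; have fi' := integrable_lebesgue_tupleS fi.
rewrite [LHS](integral_pushforward (@measurable_tuple_cons R n)
  (mu := product_measure1 mu (L n)))//.
  by rewrite preimage_setT -integral12_prod_meas1.
exact: measurable_int fi.
Qed.

Lemma integrable_expR_norm1_tuple n (c : R) : 0 < c ->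
  (L n).-integrable setT (fun z => (expR (- (c * norm1_tuple z)))%:E).
Proof.
move=> c0.
have mexp m : measurable_fun setT (fun z : m.-tuple R => expR (- (c * norm1_tuple z))).
  apply: measurableT_comp => //; apply: measurableT_comp => //.
  by apply: measurable_funM => //; exact: measurable_norm1_tuple.
apply/integrableP; split; first by apply/measurable_EFinP; exact: mexp.
under eq_integral do rewrite /= ger0_norm ?expR_ge0//.
elim: n => [|n IH].
  rewrite integral_dirac//; last by apply/measurable_EFinP; exact: mexp.
  by rewrite diracE mem_set// mul1e ltry.
rewrite (@ge0_integral_lebesgue_tupleS n); last 2 first.
- by apply/measurable_EFinP; exact: mexp.
- by move=> z; rewrite lee_fin expR_ge0.
under eq_integral do under eq_integral do
  rewrite norm1_tuple_cons mulrDr opprD expRD EFinM.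
under eq_integral => x _.
  rewrite ge0_integralZl; last 4 first.
  - by [].
  - by apply/measurable_EFinP; exact: mexp.
  - by move=> z _; rewrite lee_fin expR_ge0.
  - by rewrite lee_fin expR_ge0.
  over.
set I := integral (@lebesgue_tuple R n) _ _ in IH *.
have /fineK <- : I \is a fin_num.
  rewrite ge0_fin_numE//.
  by apply: integral_ge0 => z _; rewrite lee_fin expR_ge0.
exact: (integrable_lty _ (integrableZr _ (fine I) (integrable_expR_normr c0))).
Qed.

Lemma integrable_le_expR n (H : n.-tuple R -> R) (c K : R) : 0 < c ->
  measurable_fun setT H ->
  (forall z, `|H z| <= K * expR (- (c * norm1_tuple z))) ->
  (L n).-integrable setT (EFin \o H).
Proof.
move=> c0 mH bH.
apply: (@le_integrable _ _ _ (L n) setT _ _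
  (fun z => (K * expR (- (c * norm1_tuple z)))%:E)) => //.
- exact/measurable_EFinP.
- by move=> z _ /=; rewrite lee_fin (le_trans (bH z))// ler_norm.
- under [X in integrable _ _ X]funext do rewrite EFinM.
  by apply: integrableZl => //; exact: integrable_expR_norm1_tuple.
Qed.

(** Fubini with coordinate [i] integrated innermost. The induction peels off the head; [K] is
    generalised because a fixed head [x] contributes the factor e^{-c|x|} to it. *)
Lemma integral_update_tuple_eq0 n (i : 'I_n) (H : n.-tuple R -> R) (c K : R) :
  0 < c -> measurable_fun setT H ->
  (forall z, `|H z| <= K * expR (- (c * norm1_tuple z))) ->
  (forall z, \int[mu]_s (H (update_tuple z i s))%:E = 0)%E ->
  (\int[L n]_z (H z)%:E = 0)%E.
Proof.
move=> c0; elim: n => [|n IH] in i H K *; first by case: i.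
move=> mH bH H0.
have iH := integrable_le_expR c0 mH bH.
rewrite integral_lebesgue_tupleS//=.
case: (unliftP ord0 i) => [j|] ij; rewrite {}ij in H0; last first.
  (* The vanishing coordinate is the head, integrated last, so the order is swapped. The head [0]
     used below is a dummy, overwritten by the update. *)
  rewrite (Fubini (integrable_lebesgue_tupleS iH)) /=.
  rewrite integral0_eq// => z _.
  have := H0 (tuple_cons (0, z)).
  by under eq_integral do rewrite update_tuple_cons0.
rewrite integral0_eq// => x _; apply: (IH j _ (K * expR (- (c * `|x|)))).
- apply: (measurableT_comp mH).
  apply: (measurableT_comp (@measurable_tuple_cons R n)).
  exact: (@pair1_measurable _ _ (measurableTypeR R) _ x).
- move=> z; rewrite (le_trans (bH _))// norm1_tuple_cons.
  by rewrite mulrDr opprD expRD mulrA.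
- move=> z; have := H0 (tuple_cons (x, z)).
  by under eq_integral do rewrite update_tuple_consS.
Qed.

End tuple_space.
(** * Functions of polynomial growth *)

Section tempered.
Context (R : realType).

(** Each factor is paid for with half of the available rate: 1 + r <= (1 + 2/c)(1 + cr/2) <= (1 +
    2/c) e^{cr/2}. Hence the induction runs over all [c]. *)
Lemma polynomial_le_expR (m : nat) (c : R) : 0 < c ->
  exists2 C, 0 < C & forall r, 0 <= r -> (1 + r) ^+ m <= C * expR (c * r).
Proof.
move=> c0; elim: m => [|m IH] in c c0 *.
  by exists 1 => // r r0; rewrite expr0 mul1r -[leLHS]expR0 ler_expR mulr_ge0// ltW.
have c20 : 0 < c / 2 by rewrite divr_gt0.
have [C C0 HC] := IH _ c20.
have d0 : 0 < 1 + 2 / c by rewrite addr_gt0// divr_gt0.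
exists ((1 + 2 / c) * C); first exact: mulr_gt0.
move=> r r0.
have -> : c * r = c / 2 * r + c / 2 * r by field.
rewrite exprS expRD mulrACA ler_pM//.
- by rewrite addr_ge0.
- by rewrite exprn_ge0// addr_ge0.
- have h := expR_ge1Dx (c / 2 * r).
  rewrite (le_trans _ (ler_wpM2l (ltW d0) h))//.
  have -> : (1 + 2 / c) * (1 + c / 2 * r) = 1 + r + (2 / c + c / 2 * r).
    by field; rewrite gt_eqF.
  by rewrite lerDl addr_ge0// ?mulr_ge0// ?invr_ge0// ltW.
- exact: HC.
Qed.

(* Split [r <= a / c + s], where [s] is the positive part of [r - a / c]. *)
Lemma polynomial_le_shifted_expR (m : nat) (c : R) : 0 < c ->
  exists2 C, 0 < C & forall a r, 0 <= a -> 0 <= r ->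
    (1 + r) ^+ m <= C * (1 + a) ^+ m * (1 + expR (c * r - a)).
Proof.
move=> c0; have [C C0 HC] := polynomial_le_expR m c0.
have d0 : 0 < 1 + c^-1 by rewrite addr_gt0// invr_gt0.
exists ((1 + c^-1) ^+ m * C); first by rewrite mulr_gt0// exprn_gt0.
move=> a r a0 r0; pose s := Num.max 0 (r - a / c).
have s0 : 0 <= s by rewrite le_max lexx.
have ac0 : 0 <= a / c by rewrite divr_ge0// ltW.
have h1 : 1 + r <= (1 + c^-1) * (1 + a) * (1 + s).
  have rs : r <= a / c + s by rewrite -lerBlDl le_max lexx orbT.
  have -> : (1 + c^-1) * (1 + a) * (1 + s) =
    1 + (a / c + s) + (a * s + a + c^-1 + a * s / c + s / c) by ring.
  rewrite (@le_trans _ _ (1 + (a / c + s)))// ?lerD2l// lerDl.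
  by rewrite !addr_ge0// ?mulr_ge0// invr_ge0 ltW.
have h2 : expR (c * s) <= 1 + expR (c * r - a).
  rewrite /s; have [ra|ra] := leP (r - a / c) 0.
    by rewrite mulr0 expR0 lerDl expR_ge0.
  have -> : c * (r - a / c) = c * r - a by field; rewrite gt_eqF.
  by rewrite lerDr.
apply: (@le_trans _ _ (((1 + c^-1) * (1 + a) * (1 + s)) ^+ m)).
  apply: lerXn2r => //; rewrite nnegrE; first exact: addr_ge0.
  by apply: mulr_ge0; [apply: mulr_ge0; [exact: ltW|exact: addr_ge0]|exact: addr_ge0].
rewrite !exprMn -!mulrA ler_wpM2l// ?exprn_ge0// ?(ltW d0)//.
rewrite mulrCA ler_wpM2l// ?exprn_ge0// ?addr_ge0//.
by rewrite (le_trans (HC _ s0))// ler_wpM2l// ltW.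
Qed.

(** Measurability is bundled with the growth bound, so that the closure lemmas deliver everything
    integrability against a Gaussian requires. *)
Definition tempered n (f : n.-tuple R -> R) :=
  measurable_fun setT f /\
  exists m K, forall z, `|f z| <= K * (1 + norm1_tuple z) ^+ m.

Lemma tempered_le n (f g : n.-tuple R -> R) : measurable_fun setT f ->
  tempered g -> (forall z, `|f z| <= `|g z|) -> tempered f.
Proof.
move=> mf [mg [m [K gK]]] fg; split => //; exists m, K => z.
exact: le_trans (fg z) (gK z).
Qed.

Lemma tempered_cst n (a : R) : tempered (fun _ : n.-tuple R => a).
Proof. by split => //; exists 0%N, `|a| => z; rewrite expr0 mulr1. Qed.

Lemma tempered_norm1_tuple n : tempered (@norm1_tuple R n).
Proof.
split; first exact: measurable_norm1_tuple.
exists 1%N, 1 => z; rewrite expr1 mul1r ger0_norm ?norm1_tuple_ge0//.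
by rewrite lerDr.
Qed.

Lemma tempered_tnth n (i : 'I_n) : tempered (fun z : n.-tuple R => tnth z i).
Proof.
apply: (tempered_le _ (tempered_norm1_tuple n)); first exact: measurable_tnth.
move=> z; rewrite [leRHS]ger0_norm ?norm1_tuple_ge0//.
by rewrite /norm1_tuple (bigD1 i)//= lerDl sumr_ge0.
Qed.

Lemma temperedM n (f g : n.-tuple R -> R) :
  tempered f -> tempered g -> tempered (fun z => f z * g z).
Proof.
move=> [mf [m [K fK]]] [mg [q [J gJ]]]; split; first exact: measurable_funM.
exists (m + q)%N, (K * J) => z.
by rewrite normrM exprD mulrACA ler_pM.
Qed.

Lemma temperedD n (f g : n.-tuple R -> R) :
  tempered f -> tempered g -> tempered (fun z => f z + g z).
Proof.
move=> [mf [m [K fK]]] [mg [q [J gJ]]]; split; first exact: measurable_funD.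
exists (m + q)%N, (`|K| + `|J|) => z.
have z1 : 1 <= 1 + norm1_tuple z by rewrite lerDl norm1_tuple_ge0.
have le_pow A k l : A * (1 + norm1_tuple z) ^+ k
    <= `|A| * (1 + norm1_tuple z) ^+ (k + l).
  rewrite (@le_trans _ _ (`|A| * (1 + norm1_tuple z) ^+ k))//.
    by rewrite ler_wpM2r ?ler_norm// exprn_ge0// (le_trans ler01).
  by rewrite ler_wpM2l// ler_weXn2l// leq_addr.
rewrite (le_trans (ler_normD _ _))// mulrDl lerD//.
  exact: le_trans (fK z) (le_pow _ _ _).
by rewrite addnC; exact: le_trans (gJ z) (le_pow _ _ _).
Qed.

Lemma temperedZ n (f : n.-tuple R -> R) a :
  tempered f -> tempered (fun z => a * f z).
Proof. by move=> tf; apply: temperedM => //; exact: tempered_cst. Qed.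

Lemma temperedB n (f g : n.-tuple R -> R) :
  tempered f -> tempered g -> tempered (fun z => f z - g z).
Proof.
move=> tf tg; apply: temperedD => //.
by under eq_fun do rewrite -mulN1r; exact: temperedZ.
Qed.

Lemma temperedX n (f : n.-tuple R -> R) k :
  tempered f -> tempered (fun z => f z ^+ k).
Proof.
move=> tf; elim: k => [|k IH].
  by under eq_fun do rewrite expr0; exact: tempered_cst.
by under eq_fun do rewrite exprS; exact: temperedM.
Qed.

Lemma tempered_sum n (I : Type) (r : seq I) (f : I -> n.-tuple R -> R) :
  (forall i, tempered (f i)) -> tempered (fun z => \sum_(i <- r) f i z).
Proof.
move=> tf; elim: r => [|i r IH].
  by under eq_fun do rewrite big_nil; exact: tempered_cst.
by under eq_fun do rewrite big_cons; exact: temperedD.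
Qed.

Lemma tempered_le_expR n (f : n.-tuple R -> R) (c : R) : 0 < c -> tempered f ->
  exists2 K, 0 <= K & forall z, `|f z| <= K * expR (c * norm1_tuple z).
Proof.
move=> c0 [mf [m [K fK]]]; have [C C0 HC] := polynomial_le_expR m c0.
exists (`|K| * C); first by rewrite mulr_ge0// ltW.
move=> z; rewrite (le_trans (fK z))//.
rewrite (@le_trans _ _ (`|K| * (1 + norm1_tuple z) ^+ m))//.
  by rewrite ler_wpM2r ?ler_norm// exprn_ge0// addr_ge0// norm1_tuple_ge0.
by rewrite -mulrA ler_wpM2l// HC// norm1_tuple_ge0.
Qed.

Definition sqnorm_tuple n (z : n.-tuple R) : R := \sum_i tnth z i ^+ 2.

(** Completing the square, a x^2 - 2|x| + 1/a = a (|x| - 1/a)^2 >= 0 in each coordinate. So the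
    Gaussian pays for e^{-2|z|_1} at the price e^{n/a}: one half absorbs the growth of [f], the
    other remains as decay. *)
Lemma tempered_mul_gauss n (f : n.-tuple R -> R) (a : R) : 0 < a ->
  tempered f ->
  exists2 K, 0 <= K & forall z,
    `|f z * expR (- (a * sqnorm_tuple z))| <= K * expR (- (1 * norm1_tuple z)).
Proof.
move=> a0 tf; have [K K0 HK] := tempered_le_expR (@ltr01 R) tf.
exists (K * expR (a^-1 *+ n)); first by rewrite mulr_ge0// expR_ge0.
move=> z; rewrite normrM (ger0_norm (expR_ge0 _)).
rewrite (le_trans (ler_wpM2r (expR_ge0 _) (HK z)))//.
rewrite -!mulrA ler_wpM2l// -!expRD ler_expR.
rewrite -subr_ge0.
have -> : a^-1 *+ n - 1 * norm1_tuple z - (1 * norm1_tuple z - a * sqnorm_tuple z)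
  = \sum_(i < n) (a * tnth z i ^+ 2 - 2 * `|tnth z i| + a^-1).
  rewrite !big_split/= sumrN -!mulr_sumr sumr_const card_ord.
  rewrite -/(norm1_tuple z) -/(sqnorm_tuple z); ring.
apply: sumr_ge0 => i _.
have -> : a * tnth z i ^+ 2 - 2 * `|tnth z i| + a^-1 =
   a * (`|tnth z i| - a^-1) ^+ 2.
  by rewrite -(real_normK (num_real (tnth z i))); field; rewrite gt_eqF.
by rewrite mulr_ge0 ?sqr_ge0// ltW.
Qed.

Lemma measurable_tempered n (f : n.-tuple R -> R) :
  tempered f -> measurable_fun setT f.
Proof. by case. Qed.

End tempered.

(** * Exponentials of quadratic polynomials *)

Section quadratic_exponent.
Context (R : realType).

(** Both the posterior weight as a function of one observation and the Gaussian density along one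
    coordinate have this shape. *)
Lemma is_derive_expR_quadratic (a b c s : R) :
  is_derive s (1 : R) (fun x : R => expR (a + b * x + c * x ^+ 2))
    (expR (a + b * s + c * s ^+ 2) * (b + 2 * c * s)).
Proof.
have [q qE] : exists q : {poly R}, q = a%:P + b *: 'X + c *: 'X^2 by eexists.
have hE x : q.[x] = a + b * x + c * x ^+ 2 by rewrite qE !hornerE.
have -> : (fun x : R => expR (a + b * x + c * x ^+ 2)) = expR \o horner q.
  by apply/funext => x /=; rewrite hE.
have := @is_derive1_comp R expR (horner q) s _ _ (is_derive_expR _)
  (is_derive_poly q s).
rewrite hE => h; apply: is_derive_eq h _; congr (_ * _).
by rewrite qE derivD derivD derivC !derivZ derivX derivXn !hornerE /=; ring.
Qed.

End quadratic_exponent.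
(** * The pseudo-posterior *)

Section measurability.
Context d1 d2 (T1 : measurableType d1) (T2 : measurableType d2) (R : realType).

(** Tonelli gives measurability in the parameter for the positive and negative parts, and
    [Rintegral] is [fine] of their difference. *)
Lemma measurable_Rintegral2 (m2 : {sigma_finite_measure set T2 -> \bar R})
  (f : T1 * T2 -> R) : measurable_fun setT f ->
  measurable_fun setT (fun x => \int[m2]_y f (x, y)).
Proof.
move=> mf; have mEf : measurable_fun setT (EFin \o f) by exact/measurable_EFinP.
have -> : (fun x => \int[m2]_y f (x, y)) =
    fine \o (fun x => fubini_F m2 (funepos (EFin \o f)) x
                    - fubini_F m2 (funeneg (EFin \o f)) x)%E.
  apply/funext => x; rewrite /Rintegral/= integralE; congr (fine (_ - _)).
    by apply: eq_integral => y _; rewrite !funeposE.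
  by apply: eq_integral => y _; rewrite !funenegE.
apply: measurableT_comp => //; apply: emeasurable_funB.
- by apply: measurable_fun_fubini_tonelli_F => //; exact: measurable_funepos.
- by apply: measurable_fun_fubini_tonelli_F => //; exact: measurable_funeneg.
Qed.

End measurability.

Section posterior.
Context (R : realType) (n p : nat) (X : 'M[R]_(n, p)) (lambda tau : R).
Hypotheses (n_gt0 : (0 < n)%N) (lambda_gt0 : 0 < lambda) (tau_gt0 : 0 < tau).
Implicit Types (y : 'cV[R]_n) (c : p.-tuple R -> R) (t : p.-tuple R).
Notation L n := (@lebesgue_tuple R n).

Let n_gt0R : (0 : R) < n%:R. Proof. by rewrite ltr0n. Qed.
Let lt_gt0 : 0 < lambda / tau. Proof. exact: divr_gt0. Qed.

Definition fit i t : R := (X *m col_of_tuple t) i 0.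

Definition weight y t : R := expR (- potential X lambda y (col_of_tuple t) / tau).

Definition weight_int y c : R := \int[L p]_t (c t * weight y t).

Definition post_mean y c : R :=
  \int[L p]_t (c t * pseudo_posterior X lambda tau y (col_of_tuple t)).

Lemma fitE i t : fit i t = \sum_j X i j * tnth t j.
Proof. by rewrite /fit mxE; apply: eq_bigr => j _; rewrite mxE. Qed.

Lemma tempered_fit i : tempered (fit i).
Proof.
rewrite (_ : fit i = fun t => \sum_j X i j * tnth t j); last first.
  by apply/funext => t; exact: fitE.
by apply: tempered_sum => j; apply: temperedZ; exact: tempered_tnth.
Qed.

Lemma potentialE y t : potential X lambda y (col_of_tuple t) =
  (2 * n%:R)^-1 * (\sum_i (y i 0 - fit i t) ^+ 2) + lambda * norm1_tuple t.
Proof.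
rewrite /potential; congr (_ * _ + _ * _).
  by apply: eq_bigr => i _; rewrite -row_mul mxE.
by apply: eq_bigr => i _; rewrite mxE.
Qed.

Lemma weight_gt0 y t : 0 < weight y t. Proof. exact: expR_gt0. Qed.

(** Only the penalty is kept, the squared residuals being nonnegative; the bound is therefore free
    of [y]. *)
Lemma weight_le y t : weight y t <= expR (- (lambda / tau * norm1_tuple t)).
Proof.
rewrite ler_expR potentialE mulNr lerN2 mulrAC ler_pM2r ?invr_gt0//.
by rewrite lerDr mulr_ge0 ?invr_ge0 ?sumr_ge0// => *; exact: sqr_ge0.
Qed.

Lemma measurable_weight2 d (T : measurableType d) (f : T -> 'cV[R]_n)
    (g : T -> p.-tuple R) :
  (forall i, measurable_fun setT (fun x => f x i 0)) -> measurable_fun setT g ->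
  measurable_fun setT (fun x => weight (f x) (g x)).
Proof.
move=> mf mg; apply: measurableT_comp => //; apply: measurable_funM => //.
apply: measurableT_comp => //.
under eq_fun do rewrite potentialE.
apply: measurable_funD; apply: measurable_funM => //.
- apply: measurable_sum => i; apply: measurable_funX; apply: measurable_funB => //.
  by apply: (measurableT_comp (measurable_tempered (tempered_fit i))).
- by apply: (measurableT_comp (measurable_norm1_tuple (n := p))).
Qed.

Lemma measurable_weight y : measurable_fun setT (weight y).
Proof. exact: measurable_weight2. Qed.

(** Half of the rate [lambda / tau] absorbs the growth of [c]; the other half is left for
    integrability. *)
Lemma integrable_weight y c : tempered c ->
  (L p).-integrable setT (EFin \o (fun t => c t * weight y t)).
Proof.
move=> tc; have [|K K0 HK] := @tempered_le_expR _ _ _ (lambda / tau / 2) _ tc.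
  by rewrite divr_gt0.
apply: (@integrable_le_expR _ _ _ (lambda / tau / 2) K).
- by rewrite divr_gt0.
- by apply: measurable_funM; [exact: measurable_tempered|exact: measurable_weight].
- move=> t; rewrite normrM (gtr0_norm (weight_gt0 _ _)).
  have w0 := ltW (weight_gt0 y t).
  rewrite (le_trans (ler_pM _ w0 (HK t) (weight_le y t)))//.
  by rewrite -[leLHS]mulrA -expRD ler_wpM2l// ler_expR; lra.
Qed.

Lemma weight_intD y c1 c2 : tempered c1 -> tempered c2 ->
  weight_int y (fun t => c1 t + c2 t) = weight_int y c1 + weight_int y c2.
Proof.
move=> t1 t2; rewrite -RintegralD//; [|exact: integrable_weight..].
by apply: eq_Rintegral => t _; rewrite mulrDl.
Qed.

Lemma weight_intZ y c a : tempered c ->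
  weight_int y (fun t => a * c t) = a * weight_int y c.
Proof.
move=> tc; rewrite -RintegralZl//; last exact: integrable_weight.
by apply: eq_Rintegral => t _; rewrite mulrA.
Qed.

(** A zero integral would force [f = 0] almost everywhere, making the whole space null, whereas the
    unit cube has measure 1. *)
Lemma Rintegral_lebesgue_tuple_gt0 (f : p.-tuple R -> R) :
  (forall t, 0 < f t) -> (L p).-integrable setT (EFin \o f) ->
  0 < \int[L p]_t f t.
Proof.
move=> f0 fi.
rewrite lt_neqAle Rintegral_ge0 ?andbT; last by move=> t _; exact: ltW.
apply/eqP => /esym I0.
have mf : measurable_fun setT (EFin \o f) := measurable_int _ fi.
have : (\int[L p]_t `|(f t)%:E| = 0)%E.
  under eq_integral do rewrite gee0_abs ?lee_fin ?(ltW (f0 _))//.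
  by rewrite -[LHS]fineK ?integrable_fin_num//= -/(Rintegral _ _ _) I0.
move/(ae_eq_integral_abs (L p) measurableT mf).1 => -[N [mN N0 sN]].
have NT : N = setT.
  apply/seteqP; split => // t _; apply: sN => /= /(_ I) /eqP.
  by rewrite eqe gt_eqF.
pose I01 : set R := `[0, 1]%classic.
pose B := [set x : p.-tuple R | forall i, I01 (tnth x i)].
have mB : measurable B.
  rewrite (_ : B = \bigcap_i ((@tnth p R ^~ i) @^-1` I01)).
    apply: fin_bigcap_measurable => // i _.
    rewrite -[X in measurable X]setTI; apply: measurable_tnth => //.
    exact: measurable_itv.
  by apply/seteqP; split => [x xA i _|x xA i]; exact: xA.
have : L p B = 1%E.
  rewrite (lebesgue_tuple_box (fun=> measurable_itv _)) big1// => i _.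
  by rewrite lebesgue_measure_itv/= lte_fin ltr01 oppr0 adde0.
have -> : L p B = 0%E by apply: (subset_measure0 mB mN _ N0); rewrite NT.
by move/eqP; rewrite eqe eq_sym oner_eq0.
Qed.

Let tempered1 : tempered (fun _ : p.-tuple R => (1 : R)).
Proof. exact: tempered_cst. Qed.

Lemma weight_int_gt0 y : 0 < weight_int y (fun=> 1).
Proof.
apply: Rintegral_lebesgue_tuple_gt0; last exact: integrable_weight.
by move=> t; rewrite mul1r weight_gt0.
Qed.

Lemma post_meanE y c : tempered c ->
  post_mean y c = weight_int y c / weight_int y (fun=> 1).
Proof.
move=> tc; rewrite -RintegralZr//; last exact: integrable_weight.
apply: eq_Rintegral => t _; rewrite /pseudo_posterior mulrA; congr (_ / _).
by apply: eq_Rintegral => s _; rewrite mul1r.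
Qed.

Lemma post_meanD y c1 c2 : tempered c1 -> tempered c2 ->
  post_mean y (fun t => c1 t + c2 t) = post_mean y c1 + post_mean y c2.
Proof.
move=> t1 t2; rewrite !post_meanE//; last exact: temperedD.
by rewrite weight_intD// mulrDl.
Qed.

Lemma post_meanZ y c a : tempered c ->
  post_mean y (fun t => a * c t) = a * post_mean y c.
Proof.
move=> tc; rewrite !post_meanE//; last exact: temperedZ.
by rewrite weight_intZ// mulrA.
Qed.

Lemma post_mean_cst y a : post_mean y (fun=> a) = a.
Proof.
rewrite -[X in post_mean _ X](_ : (fun=> a * 1) = _); last first.
  by apply/funext => t; rewrite mulr1.
by rewrite post_meanZ// post_meanE// divff ?mulr1// gt_eqF// weight_int_gt0.
Qed.

Lemma post_mean_sum y (I : Type) (r : seq I) (c : I -> p.-tuple R -> R) :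
  (forall i, tempered (c i)) ->
  post_mean y (fun t => \sum_(i <- r) c i t) = \sum_(i <- r) post_mean y (c i).
Proof.
move=> tc; elim: r => [|i r IH].
  by under eq_fun do rewrite big_nil; rewrite post_mean_cst big_nil.
under eq_fun do rewrite big_cons; rewrite post_meanD//; last exact: tempered_sum.
by rewrite IH big_cons.
Qed.

(** * Polynomial growth of posterior means in the observations *)

Let energy y : R := (n%:R * tau)^-1 * sqnorm2 y.

Let energy_ge0 y : 0 <= energy y.
Proof.
rewrite mulr_ge0 ?sumr_ge0// => [|i _]; last exact: sqr_ge0.
by rewrite invr_ge0 mulr_ge0// ltW.
Qed.

Let base t : R := expR (- ((n%:R^-1 * \sum_i fit i t ^+ 2
  + lambda * norm1_tuple t) / tau)).

(** The variables separate through (u - v)^2 <= 2u^2 + 2v^2, whose factor 2 cancels the one half of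
    the potential; hence no one half in [energy] and [base]. *)
Lemma weight_ge y t : expR (- energy y) * base t <= weight y t.
Proof.
rewrite -expRD ler_expR potentialE.
set s := \sum_i (y i 0 - fit i t) ^+ 2.
have : s <= 2 * sqnorm2 y + 2 * \sum_i fit i t ^+ 2.
  rewrite !mulr_sumr -big_split/=; apply: ler_sum => i _.
  have sq (a b : R) : (a - b) ^+ 2 <= 2 * a ^+ 2 + 2 * b ^+ 2.
    by have := sqr_ge0 (a + b); nra.
  exact: sq.
move=> h.
have {}h : (2 * n%:R)^-1 * s <= n%:R^-1 * (sqnorm2 y + \sum_i fit i t ^+ 2).
  rewrite (le_trans (ler_wpM2l _ h))//.
  by rewrite -mulrDr invfM mulrA (mulrAC _ _ 2) mulVf ?mul1r// pnatr_eq0.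
rewrite mulNr -opprD lerN2 /energy -subr_ge0.
have -> : forall a b, (n%:R * tau)^-1 * sqnorm2 y +
    (n%:R^-1 * b + lambda * norm1_tuple t) / tau - (a + lambda * norm1_tuple t) / tau
  = (n%:R^-1 * (sqnorm2 y + b) - a) / tau :> R.
  by move=> a b; rewrite invfM; ring.
by rewrite divr_ge0 ?(ltW tau_gt0)// subr_ge0.
Qed.

Let integrable_base : (L p).-integrable setT (EFin \o base).
Proof.
apply: (@integrable_le_expR _ _ _ (lambda / tau) 1) => //.
- apply: measurableT_comp => //; apply: measurableT_comp => //.
  apply: measurable_funM => //; apply: measurable_funD; apply: measurable_funM => //.
    apply: measurable_sum => i; apply: measurable_funX.
    exact: measurable_tempered (tempered_fit i).
  exact: measurable_norm1_tuple.
- move=> t; rewrite mul1r ger0_norm ?expR_ge0// ler_expR lerN2 mulrAC.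
  rewrite ler_pM2r ?invr_gt0// lerDr mulr_ge0 ?invr_ge0 ?sumr_ge0 ?(ltW n_gt0R)//.
  by move=> i _; exact: sqr_ge0.
Qed.

(* With [a = energy y], the normalising constant is at least [c0 e^{-a}] and
   [e^{delta |t|_1}] has weighted integral at most [c1], so that the posterior
   mean of [e^{delta |t|_1 - a}] is bounded uniformly in [y]. *)
Lemma post_mean_polynomial_le c : tempered c ->
  exists m K, forall y, `|post_mean y c| <= K * (1 + energy y) ^+ m.
Proof.
move=> tc; have mc := measurable_tempered tc.
have [m [K0 cK0]] := tc.2; set K := `|K0|.
have cK t : `|c t| <= K * (1 + norm1_tuple t) ^+ m.
  rewrite (le_trans (cK0 t))// ler_wpM2r ?ler_norm//.
  by rewrite exprn_ge0// addr_ge0// norm1_tuple_ge0.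
(* Half of the decay rate of the weight, so that e^{delta |t|_1} times the weight still decays at
   rate [delta]. *)
have [delta delta0 deltaE] : exists2 d, 0 < d & d = lambda / tau / 2.
  by exists (lambda / tau / 2); rewrite ?divr_gt0.
have [C C0 HC] := polynomial_le_shifted_expR m delta0.
pose c0 := \int[L p]_t base t.
have c00 : 0 < c0 by apply: Rintegral_lebesgue_tuple_gt0 => // t; exact: expR_gt0.
pose c1 := \int[L p]_t expR (- (delta * norm1_tuple t)).
have ic1 := integrable_expR_norm1_tuple p delta0.
exists m, (K * C * (1 + c1 / c0)) => y; set a := energy y.
have a0 : 0 <= a := energy_ge0 y.
have Z0 := weight_int_gt0 y.
have Zc0 : expR (- a) * c0 <= weight_int y (fun=> 1).
  rewrite -RintegralZl//; apply: le_Rintegral => //.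
  - have := integrableZl measurableT (expR (- a)) integrable_base.
    by under [X in integrable _ _ X -> _]funext do rewrite -EFinM.
  - exact: integrable_weight.
  - by move=> t _; rewrite mul1r; exact: weight_ge.
have Ic1 : `|weight_int y c| <=
    K * C * (1 + a) ^+ m * (weight_int y (fun=> 1) + expR (- a) * c1).
  rewrite (le_trans (le_normr_Rintegral _ _))//; first exact: integrable_weight.
  have i1 := integrable_weight y tempered1.
  have i2 : (L p).-integrable setT
      (EFin \o (fun t => expR (- a) * expR (- (delta * norm1_tuple t)))).
    have := integrableZl measurableT (expR (- a)) ic1.
    by under [X in integrable _ _ X -> _]funext do rewrite -EFinM.
  have i3 : (L p).-integrable setT (EFin \o (fun t => 1 * weight y t +
      expR (- a) * expR (- (delta * norm1_tuple t)))).
    have := integrableD measurableT i1 i2.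
    by under [X in integrable _ _ X -> _]funext do rewrite -EFinD.
  rewrite /c1 -RintegralZl// -RintegralD// -RintegralZl//.
  apply: le_Rintegral => //.
  - exact: (integrable_norm (integrable_weight y tc)).
  - have := integrableZl measurableT (K * C * (1 + a) ^+ m) i3.
    by under [X in integrable _ _ X -> _]funext do rewrite -EFinM.
  move=> t _; rewrite normrM (gtr0_norm (weight_gt0 _ _)).
  have n1 := norm1_tuple_ge0 t.
  have w0 := ltW (weight_gt0 y t).
  rewrite (le_trans (ler_wpM2r w0 (cK t)))// -!mulrA ler_wpM2l ?normr_ge0//.
  rewrite (le_trans (ler_wpM2r w0 (HC _ _ a0 n1)))// -!mulrA.
  rewrite ler_wpM2l ?(ltW C0)// ler_wpM2l ?exprn_ge0 ?addr_ge0//.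
  rewrite mulrDl lerD2l expRD mulrC mulrA mulrC ler_wpM2l ?expR_ge0//.
  rewrite (le_trans (ler_wpM2r (expR_ge0 _) (weight_le y t)))//.
  by rewrite -expRD ler_expR deltaE; lra.
rewrite post_meanE// normrM normfV (gtr0_norm Z0) ler_pdivrMr//.
rewrite (le_trans Ic1)// -!mulrA ler_wpM2l ?normr_ge0// ler_wpM2l ?(ltW C0)//.
rewrite [leRHS]mulrCA ler_wpM2l ?exprn_ge0 ?addr_ge0//.
rewrite mulrDl mul1r lerD2l.
have c10 : 0 <= c1 / c0.
  by rewrite divr_ge0 ?(ltW c00)// Rintegral_ge0// => t _; exact: expR_ge0.
(* The factor e^{-a} in front of [c1] meets the same factor in the lower bound of the normaliser, so
   no exponential in [a] survives the division. *)
rewrite (le_trans _ (ler_wpM2l c10 Zc0))//.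
by rewrite le_eqVlt; apply/orP; left; apply/eqP; field; rewrite gt_eqF.
Qed.

Lemma measurable_post_mean d (T : measurableType d) (f : T -> 'cV[R]_n) c :
  tempered c -> (forall i, measurable_fun setT (fun x => f x i 0)) ->
  measurable_fun setT (fun x => post_mean (f x) c).
Proof.
move=> tc mf.
have mI c' : tempered c' -> measurable_fun setT (fun x => weight_int (f x) c').
  move=> tc'.
  apply: (@measurable_Rintegral2 _ _ T _ R (L p)
    (fun xt => c' xt.2 * weight (f xt.1) xt.2)).
  apply: measurable_funM.
    by apply: (measurableT_comp (measurable_tempered tc')).
  apply: measurable_weight2 => // i.
  by apply: (measurableT_comp (mf i)).
(* The reciprocal of the positive normaliser is written as e^{-ln}, a composition of measurable
   functions. *)
have -> : (fun x => post_mean (f x) c) = (fun x => weight_int (f x) c *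
    expR (- ln (weight_int (f x) (fun=> 1)))).
  apply/funext => x; rewrite post_meanE// expRN lnK// posrE.
  exact: weight_int_gt0.
apply: measurable_funM; first exact: mI.
apply: measurableT_comp => //; apply: measurableT_comp => //.
apply: (measurableT_comp (@measurable_ln R)); exact: mI.
Qed.

(** * Differentiation of posterior means in one observation *)

Definition coord_line y i (s : R) : 'cV[R]_n := y + s *: delta_mx i 0.

Lemma coord_lineE y i s j : coord_line y i s j 0 = y j 0 + s * (j == i)%:R.
Proof. by rewrite !mxE eqxx andbT. Qed.

(** Only the [i]-th residual moves with [s], so the exponent is quadratic in [s]. *)
Lemma is_derive_weight y i s t :
  is_derive s (1 : R) (fun s => weight (coord_line y i s) t)
    (weight (coord_line y i s) t *
      ((n%:R * tau)^-1 * (fit i t - coord_line y i s i 0))).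
Proof.
pose k : R := (n%:R * tau)^-1.
pose a : R := - potential X lambda y (col_of_tuple t) / tau.
have E x : weight (coord_line y i x) t =
    expR (a + k * (fit i t - y i 0) * x + (- (k / 2)) * x ^+ 2).
  rewrite /weight /a !potentialE; congr expR.
  have -> : \sum_j (coord_line y i x j 0 - fit j t) ^+ 2 =
      \sum_j (y j 0 - fit j t) ^+ 2 + (2 * x * (y i 0 - fit i t) + x ^+ 2).
    rewrite (bigD1 i)//= [in RHS](bigD1 i)//= coord_lineE eqxx mulr1.
    rewrite (eq_bigr (fun j => (y j 0 - fit j t) ^+ 2)); last first.
      by move=> j /negbTE ji; rewrite coord_lineE ji mulr0 addr0.
    ring.
  rewrite /k invfM invfM; field.
  by rewrite !gt_eqF.
have := @is_derive_expR_quadratic R a (k * (fit i t - y i 0)) (- (k / 2)) s.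
rewrite -E; under eq_fun do rewrite -E.
move=> h; apply: is_derive_eq h _; congr (_ * _).
by rewrite coord_lineE eqxx mulr1 -/k; field.
Qed.

Lemma is_derive_weight_int y i s c : tempered c ->
  is_derive s (1 : R) (fun s => weight_int (coord_line y i s) c)
    ((n%:R * tau)^-1 * (weight_int (coord_line y i s) (fun t => c t * fit i t)
      - coord_line y i s i 0 * weight_int (coord_line y i s) c)).
Proof.
move=> tc; set k := (n%:R * tau)^-1.
have k0 : 0 <= k by rewrite invr_ge0 mulr_ge0// ltW.
pose f s t := c t * weight (coord_line y i s) t.
(* [b] bounds the moving observation over the unit neighbourhood of [s]. In [G] the weight is
   replaced by its [y]-free bound, which makes the domination uniform there. *)
pose b := `|y i 0| + (`|s| + 1).
pose G t := k * (`|c t| * ((`|fit i t| + b) * expR (- (lambda / tau * norm1_tuple t)))).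
have df x t : is_derive x (1 : R) (f ^~ t)
    (c t * (weight (coord_line y i x) t * (k * (fit i t - coord_line y i x i 0)))).
  by have := is_deriveZ (c t) (is_derive_weight y i x t).
have pE x t : partial1of2 f x t =
    c t * (weight (coord_line y i x) t * (k * (fit i t - coord_line y i x i 0))).
  by rewrite partial1of2E; case: (df x t).
have sI : `]s - 1, s + 1[%classic s by rewrite /= in_itv/= ltrBlDr ltrDl ltr01.
have If x : `]s - 1, s + 1[%classic x -> (L p).-integrable setT (EFin \o f x).
  by move=> _; exact: integrable_weight.
have Df (x : R) t : `]s - 1, s + 1[%classic x -> setT t -> derivable (f ^~ t) x 1.
  by move=> _ _; exact: ex_derive.
have G0 t : 0 <= G t.
  rewrite /G mulr_ge0// mulr_ge0// mulr_ge0 ?expR_ge0// addr_ge0//.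
  by rewrite addr_ge0// addr_ge0.
have IG : (L p).-integrable setT (EFin \o G).
  have tG : tempered (fun t => k * (`|c t| * (`|fit i t| + b))).
    have tn g : tempered g -> tempered (fun t : p.-tuple R => `|g t|).
      move=> tg; apply: (tempered_le _ tg); last by move=> t; rewrite normr_id.
      by apply: measurableT_comp => //; exact: measurable_tempered.
    apply: temperedZ; apply: temperedM; first exact: tn.
    by apply: temperedD; [exact: tn (tempered_fit i)|exact: tempered_cst].
  have d0 : 0 < lambda / tau / 2 by rewrite divr_gt0.
  have [K K0 HK] := tempered_le_expR d0 tG.
  apply: (@integrable_le_expR _ _ _ (lambda / tau / 2) K) => //.
    rewrite (_ : G = fun t => k * (`|c t| * (`|fit i t| + b)) *
      expR (- (lambda / tau * norm1_tuple t))); last first.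
      by apply/funext => t; rewrite /G; ring.
    apply: measurable_funM; first exact: measurable_tempered.
    apply: measurableT_comp => //; apply: measurableT_comp => //.
    by apply: measurable_funM => //; exact: measurable_norm1_tuple.
  move=> t; rewrite /G.
  have -> : forall e, k * (`|c t| * ((`|fit i t| + b) * e)) =
    k * (`|c t| * (`|fit i t| + b)) * e by move=> e; ring.
  rewrite normrM (ger0_norm (expR_ge0 _)).
  rewrite (le_trans (ler_wpM2r (expR_ge0 _) (HK t)))//.
  by rewrite -[leLHS]mulrA -expRD ler_wpM2l// ler_expR; lra.
have Gub (x : R) t : `]s - 1, s + 1[%classic x -> setT t ->
    `|partial1of2 f x t| <= G t.
  move=> /=; rewrite in_itv/= => /andP[x1 x2] _.
  rewrite pE /G normrM [leRHS]mulrCA ler_wpM2l//.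
  rewrite normrM mulrC normrM (ger0_norm k0) -[leLHS]mulrA ler_wpM2l//.
  rewrite ler_pM// ?(gtr0_norm (weight_gt0 _ _)) ?weight_le//.
  rewrite (le_trans (ler_normB _ _))// lerD2l coord_lineE eqxx mulr1.
  rewrite (le_trans (ler_normD _ _))// lerD2l.
  have -> : x = s + (x - s) by ring.
  rewrite (le_trans (ler_normD _ _))// lerD2l ler_norml.
  by rewrite lerBlDr lerBrDl; apply/andP; split; lra.
apply: DeriveDef.
  exact: (derivable_under_integral measurableT sI If Df G0 IG Gub).
rewrite -derive1E (differentiation_under_integral measurableT sI If Df G0 IG Gub).
have tcf : tempered (fun t => c t * fit i t).
  by apply: temperedM => //; exact: tempered_fit.
transitivity (weight_int (coord_line y i s)
  (fun t => k * (c t * fit i t + (- coord_line y i s i 0) * c t))).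
  by apply: eq_Rintegral => t _; rewrite pE; ring.
rewrite weight_intZ; last by apply: temperedD => //; exact: temperedZ.
by rewrite weight_intD ?weight_intZ ?mulNr//; exact: temperedZ.
Qed.

Definition post_cov y c1 c2 : R :=
  post_mean y (fun t => c1 t * c2 t) - post_mean y c1 * post_mean y c2.

(** In the quotient rule the terms carrying the observation [coord_line y i s i 0] cancel between
    numerator and normaliser, which leaves a covariance. *)
Lemma is_derive_post_mean y i s c : tempered c ->
  is_derive s (1 : R) (fun s => post_mean (coord_line y i s) c)
    ((n%:R * tau)^-1 * post_cov (coord_line y i s) c (fit i)).
Proof.
move=> tc.
have tf := tempered_fit i.
have W0 := weight_int_gt0 (coord_line y i s).
have dN := is_derive_weight_int y i s tc.
have dZ := is_derive_weight_int y i s tempered1.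
have dV := is_deriveV (lt0r_neq0 W0) dZ.
have := is_deriveM dN dV.
rewrite (_ : _ * _ = fun s => post_mean (coord_line y i s) c); last first.
  by apply/funext => x; rewrite post_meanE.
move=> h; apply: is_derive_eq h _.
rewrite /post_cov !post_meanE//; last exact: temperedM.
rewrite (_ : (fun t => 1 * fit i t) = fit i); last first.
  by apply/funext => t; rewrite mul1r.
rewrite /GRing.scale/=; field.
by rewrite !gt_eqF.
Qed.

(** Integration by parts asks for a continuous derivative; a covariance is built from posterior
    means, which are differentiable. *)
Lemma continuous_post_cov y i c1 c2 : tempered c1 -> tempered c2 ->
  continuous (fun s => post_cov (coord_line y i s) c1 c2).
Proof.
move=> t1 t2 s.
have cm c : tempered c ->
    {for s, continuous (fun s => post_mean (coord_line y i s) c)}.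
  move=> tc; apply/differentiable_continuous/derivable1_diffP.
  by have := is_derive_post_mean y i s tc; case.
by apply: cvgB; [|apply: cvgM]; apply: cm => //; exact: temperedM.
Qed.

End posterior.
(** * Stein's identity *)

Section stein.
Context (R : realType).
Notation mu := (@lebesgue_measure R).
Notation L n := (@lebesgue_tuple R n).

Lemma tnth_update_tuple n (z : n.-tuple R) (i j : 'I_n) (s : R) :
  tnth (update_tuple z i s) j = if j == i then s else tnth z j.
Proof. by rewrite tnth_mktuple. Qed.

Lemma norm_le_norm1_update n (z : n.-tuple R) (i : 'I_n) (s : R) :
  `|s| <= norm1_tuple (update_tuple z i s).
Proof.
rewrite /norm1_tuple (bigD1 i)//= tnth_update_tuple eqxx lerDl.
by rewrite sumr_ge0.
Qed.

(** The integrand is the derivative along coordinate [i] of [h] times the Gaussian factor, -2 a z_i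
    being the logarithmic derivative of that factor. It integrates to 0 on each line, hence on the
    whole space. *)
Lemma gauss_integration_by_parts n (i : 'I_n) (h D : n.-tuple R -> R) (a : R) :
  0 < a -> tempered h -> tempered D ->
  (forall z s, is_derive s (1 : R) (fun s => h (update_tuple z i s))
    (D (update_tuple z i s))) ->
  (forall z, continuous (fun s => D (update_tuple z i s))) ->
  (\int[L n]_z ((D z - 2 * a * tnth z i * h z)
    * expR (- (a * sqnorm_tuple z)))%:E = 0)%E.
Proof.
move=> a0 th tD dh cD.
pose phi (z : n.-tuple R) := expR (- (a * sqnorm_tuple z)).
pose g z := D z - 2 * a * tnth z i * h z.
have tz := tempered_tnth R i.
have tg : tempered g.
  by apply: temperedB => //; apply: temperedM => //; exact: temperedZ.
have [K1 K10 HK1] := tempered_mul_gauss a0 th.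
have [K2 K20 HK2] := tempered_mul_gauss a0 tg.
apply: (integral_update_tuple_eq0 (i := i) ltr01 _ HK2).
  apply: measurable_funM; first exact: measurable_tempered.
  apply: measurableT_comp => //; apply: measurableT_comp => //.
  apply: measurable_funM => //; apply: measurable_sum => j.
  by apply: measurable_funX; exact: measurable_tnth.
move=> z.
pose S := \sum_(j | j != i) tnth z j ^+ 2.
have phiE s : phi (update_tuple z i s) = expR (- (a * S) + 0 * s + (- a) * s ^+ 2).
  rewrite /phi /sqnorm_tuple (bigD1 i)//= tnth_update_tuple eqxx.
  congr expR; rewrite (eq_bigr (fun j => tnth z j ^+ 2)) -/S; first by ring.
  by move=> j /negbTE ji; rewrite tnth_update_tuple ji.
have dphi s : is_derive s (1 : R) (fun s => phi (update_tuple z i s))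
    (phi (update_tuple z i s) * (- (2 * a * s))).
  under eq_fun do rewrite phiE.
  rewrite phiE; apply: is_derive_eq (is_derive_expR_quadratic _ _ _ _) _.
  by congr (_ * _); ring.
have dF s : is_derive s (1 : R)
    (fun s => h (update_tuple z i s) * phi (update_tuple z i s))
    (g (update_tuple z i s) * phi (update_tuple z i s)).
  have := is_deriveM (dh z s) (dphi s).
  move=> H; apply: is_derive_eq H _.
  rewrite /GRing.scale/= /g tnth_update_tuple eqxx; ring.
have cts (f f' : R -> R) : (forall s, is_derive s (1 : R) f (f' s)) -> continuous f.
  move=> df s; apply/differentiable_continuous/derivable1_diffP.
  by have := df s; case.
(* One constant must serve the primitive, bounded with [K1], and its derivative, bounded with
   [K2]. *)
apply: (@integral_derive_eq0 R _ _ 1 (K1 + K2) ltr01 dF).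
- move=> s; apply: cvgM; last exact: (cts _ _ dphi).
  rewrite /g; apply: cvgB; first exact: cD.
  apply: cvgM; last exact: (cts _ _ (dh z)).
  apply: cvgM; first exact: cvg_cst.
  under eq_fun do rewrite tnth_update_tuple eqxx.
  by rewrite tnth_update_tuple eqxx; exact: cvg_id.
- move=> s; rewrite (le_trans (HK1 _))// ler_pM ?expR_ge0// ?lerDl//.
  by rewrite ler_expR lerN2 !mul1r norm_le_norm1_update.
- move=> s; rewrite (le_trans (HK2 _))// ler_pM ?expR_ge0// ?lerDr//.
  by rewrite ler_expR lerN2 !mul1r norm_le_norm1_update.
Qed.

(** The normalising constant stays existential: Stein's identity is homogeneous in the density, so
    only the sign of [C] matters. *)
Lemma gaussian_pdf_scalarE n (sigma : R) : exists2 C, 0 <= C &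
  forall z : n.-tuple R, gaussian_pdf 0 (sigma ^+ 2)%:M (col_of_tuple z)
    = C * expR (- ((2 * sigma ^+ 2)^-1 * sqnorm_tuple z)).
Proof.
eexists; last first.
  move=> z; rewrite /gaussian_pdf; congr (_ * expR _).
  rewrite subr0 invmx_scalar mul_mx_scalar -scalemxAl !mxE invfM.
  rewrite (_ : \sum_j _ = sqnorm_tuple z); last first.
    by apply: eq_bigr => i _; rewrite !mxE expr2.
  by rewrite expr2 !invfM; ring.
by rewrite invr_ge0 sqrtr_ge0.
Qed.

End stein.

(** * From Lebesgue integrals to expectations over the noise *)

Section gaussian_transfer.
Context (R : realType) d (Omega : measurableType d) (P : probability Omega R).
Context n (xi : {RV P >-> n.-tuple R}) (sigma : R).
Hypotheses (sigma_gt0 : 0 < sigma)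
  (xi_gauss : gaussian_vector xi 0 (sigma ^+ 2)%:M).
Notation L n := (@lebesgue_tuple R n).

Let pdf (z : n.-tuple R) := gaussian_pdf 0 (sigma ^+ 2)%:M (col_of_tuple z).

Let a := (2 * sigma ^+ 2)^-1.

Let a_gt0 : 0 < a. Proof. by rewrite invr_gt0 mulr_gt0// exprn_gt0. Qed.

Let pdf_ge0 z : 0 <= pdf z.
Proof.
have [C C0 E] := @gaussian_pdf_scalarE R n sigma.
by rewrite /pdf E mulr_ge0// expR_ge0.
Qed.

Let measurable_pdf : measurable_fun setT pdf.
Proof.
have [C C0 E] := @gaussian_pdf_scalarE R n sigma.
rewrite (_ : pdf = fun z => C * expR (- (a * sqnorm_tuple z))); last first.
  by apply/funext => z; exact: E.
apply: measurable_funM => //.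
apply: measurableT_comp => //; apply: measurableT_comp => //.
apply: measurable_funM => //; apply: measurable_sum => j.
by apply: measurable_funX; exact: measurable_tnth.
Qed.

Lemma integrable_tempered_gaussian (f : n.-tuple R -> R) : tempered f ->
  P.-integrable setT (EFin \o (f \o xi)).
Proof.
move=> tf; have mf := measurable_tempered tf.
have : (distribution P xi).-integrable setT (EFin \o f).
  apply/(integrable_density measurable_pdf pdf_ge0 xi_gauss mf).
  have [C C0 E] := @gaussian_pdf_scalarE R n sigma.
  have [K K0 HK] := tempered_mul_gauss a_gt0 tf.
  apply: (@integrable_le_expR _ _ _ 1 (C * K)) => //.
    by apply: measurable_funM.
  move=> z; rewrite /pdf E mulrCA normrM (ger0_norm C0) -mulrA.
  by rewrite ler_wpM2l.
move=> /integrableP[_ foo]; apply/integrableP; split.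
  by apply/measurable_EFinP; exact: measurableT_comp.
move: foo; rewrite ge0_integral_distribution//.
by apply: measurableT_comp => //; exact/measurable_EFinP.
Qed.

Lemma gaussian_stein i (h D : n.-tuple R -> R) :
  tempered h -> tempered D ->
  (forall z s, is_derive s (1 : R) (fun s => h (update_tuple z i s))
    (D (update_tuple z i s))) ->
  (forall z, continuous (fun s => D (update_tuple z i s))) ->
  (\int[P]_w (tnth (xi w) i * h (xi w) - sigma ^+ 2 * D (xi w))%:E = 0)%E.
Proof.
move=> th tD dh cD.
pose f z := tnth z i * h z - sigma ^+ 2 * D z.
have tf : tempered f.
  apply: temperedB; last exact: temperedZ.
  by apply: temperedM => //; exact: tempered_tnth.
have mf := measurable_tempered tf.
rewrite -[LHS](@integral_distribution _ _ _ _ _ P xi (EFin \o f)); last 2 first.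
- exact/measurable_EFinP.
- exact: (integrable_tempered_gaussian tf).
rewrite (integral_density measurable_pdf pdf_ge0 xi_gauss mf).
have [C C0 E] := @gaussian_pdf_scalarE R n sigma.
have s0 : sigma != 0 by rewrite gt_eqF.
(* Since 2a = 1 / sigma^2, z_i h - sigma^2 D equals -sigma^2 (D - 2 a z_i h); the density
   contributes [C]. *)
rewrite -[RHS](mule0 (- (C * sigma ^+ 2))%:E).
rewrite -(gauss_integration_by_parts a_gt0 th tD dh cD) -integralZl//.
  apply: eq_integral => z _; rewrite -EFinM; congr EFin.
  by rewrite /pdf E /f -/a /a; field.
have tg : tempered (fun z => D z - 2 * a * tnth z i * h z).
  apply: temperedB => //; apply: temperedM => //.
  by apply: temperedZ; exact: tempered_tnth.
have [K K0 HK] := tempered_mul_gauss a_gt0 tg.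
apply: integrable_le_expR HK => //.
apply: measurable_funM; first exact: measurable_tempered.
apply: measurableT_comp => //; apply: measurableT_comp => //.
apply: measurable_funM => //; apply: measurable_sum => j.
by apply: measurable_funX; exact: measurable_tnth.
Qed.

End gaussian_transfer.
(** * Risk of the exponentially weighted aggregate *)

Section ewa_risk.
Context (R : realType) (n p : nat) (X : 'M[R]_(n, p)) (lambda tau : R).
Hypotheses (n_gt0 : (0 < n)%N) (lambda_gt0 : 0 < lambda) (tau_gt0 : 0 < tau).
Implicit Types (y m : 'cV[R]_n) (z : n.-tuple R).

Notation pm := (post_mean X lambda tau).
Notation cov := (post_cov X lambda tau).
Notation fit := (fit X).

Let col_subE (v w : 'cV[R]_n) i : (v - w) i 0 = v i 0 - w i 0.
Proof. by rewrite !mxE. Qed.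

Lemma mul_ewaE y i : (X *m ewa X lambda tau y) i 0 = pm y (fit i).
Proof.
rewrite (_ : fit i = fun t => \sum_j X i j * tnth t j); last first.
  by apply/funext => t; exact: fitE.
rewrite post_mean_sum//; last by move=> j; apply: temperedZ; exact: tempered_tnth.
rewrite mxE; apply: eq_bigr => j _.
by rewrite post_meanZ//; [rewrite mxE|exact: tempered_tnth].
Qed.

Lemma post_varE y : \int[@lebesgue_tuple R p]_t
    (sqnorm2 (X *m (col_of_tuple t - ewa X lambda tau y))
     * pseudo_posterior X lambda tau y (col_of_tuple t))
  = \sum_i cov y (fit i) (fit i).
Proof.
have tf i := tempered_fit X i.
(* The square of [fit i t] centred at its posterior mean, expanded so that linearity applies; the
   last two terms average to minus the squared mean. *)
pose q i t := fit i t * fit i t +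
  ((- (2 * pm y (fit i))) * fit i t + pm y (fit i) * pm y (fit i)).
have t1 i : tempered (fun t => (- (2 * pm y (fit i))) * fit i t) by exact: temperedZ.
have t2 i : tempered (fun t => (- (2 * pm y (fit i))) * fit i t
    + pm y (fit i) * pm y (fit i)).
  by apply: temperedD => //; exact: tempered_cst.
have t3 i : tempered (fun t => fit i t * fit i t) by exact: temperedM.
transitivity (pm y (fun t => \sum_i q i t)).
  apply: eq_Rintegral => t _; congr (_ * _); apply: eq_bigr => i _.
  by rewrite mulmxBr col_subE mul_ewaE -/(fit i t) /q; ring.
rewrite post_mean_sum//; last by move=> i; exact: temperedD.
apply: eq_bigr => i _.
rewrite /q post_meanD// post_meanD//; last exact: tempered_cst.
by rewrite post_mean_cst// post_meanZ// /post_cov; ring.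
Qed.

Definition observation m z : 'cV[R]_n := m + col_of_tuple z.

(** Reconciles overwriting a noise coordinate with translating an observation: the base point has
    its [i]-th noise set to 0, so that the translation by [s] is the new value. *)
Lemma observation_update m z i s :
  observation m (update_tuple z i s)
  = coord_line (observation m (update_tuple z i 0)) i s.
Proof.
apply/matrixP => j k; rewrite ord1 coord_lineE /observation !mxE !tnth_update_tuple.
by case: eqP => _; rewrite ?mulr1 ?mulr0 !addr0.
Qed.

(** Posterior means are polynomially bounded in the energy of the observation, itself a quadratic
    polynomial in the noise. *)
Lemma tempered_post_mean m c : tempered c -> tempered (fun z => pm (observation m z) c).
Proof.
move=> tc.
have mobs i : measurable_fun setT (fun z => observation m z i 0).
  under eq_fun do rewrite !mxE.
  by apply: measurable_funD => //; exact: measurable_tnth.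
have [k [K HK]] := post_mean_polynomial_le X n_gt0 lambda_gt0 tau_gt0 tc.
apply: (tempered_le (g := fun z => K *
  (1 + (n%:R * tau)^-1 * sqnorm2 (observation m z)) ^+ k)).
- exact: measurable_post_mean.
- apply: temperedZ; apply: temperedX; apply: temperedD; first exact: tempered_cst.
  apply: temperedZ; apply: tempered_sum => i; apply: temperedX.
  under eq_fun do rewrite !mxE.
  by apply: temperedD; [exact: tempered_cst|exact: tempered_tnth].
- by move=> z; rewrite (le_trans (HK _))// ler_norm.
Qed.

Lemma tempered_post_cov m c1 c2 : tempered c1 -> tempered c2 ->
  tempered (fun z => cov (observation m z) c1 c2).
Proof.
move=> t1 t2; apply: temperedB; last apply: temperedM.
all: by apply: tempered_post_mean => //; exact: temperedM.
Qed.

Definition stein_field m i z : R := tnth z i - 2 * (pm (observation m z) (fit i) - m i 0).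

Definition stein_deriv m i z : R :=
  1 - 2 * ((n%:R * tau)^-1 * cov (observation m z) (fit i) (fit i)).

Lemma tempered_stein_field m i : tempered (stein_field m i).
Proof.
apply: temperedB; first exact: tempered_tnth.
apply: temperedZ; apply: temperedB; last exact: tempered_cst.
by apply: tempered_post_mean; exact: tempered_fit.
Qed.

Lemma tempered_stein_deriv m i : tempered (stein_deriv m i).
Proof.
apply: temperedB; first exact: tempered_cst.
apply: temperedZ; apply: temperedZ.
by apply: tempered_post_cov; exact: tempered_fit.
Qed.

Lemma is_derive_stein_field m i z s :
  is_derive s (1 : R) (fun s => stein_field m i (update_tuple z i s))
    (stein_deriv m i (update_tuple z i s)).
Proof.
have tf := tempered_fit X i.
have dp := is_derive_post_mean X n_gt0 lambda_gt0 tau_gt0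
  (observation m (update_tuple z i 0)) i s tf.
have := is_deriveB (is_derive_id s (1 : R))
  (is_deriveZ 2 (is_deriveB dp (is_derive_cst (m i 0) s (1 : R)))).
rewrite (_ : id - _ = fun s => stein_field m i (update_tuple z i s)); last first.
  apply/funext => x; rewrite /stein_field tnth_update_tuple eqxx.
  by rewrite (observation_update m z i x).
move=> h; apply: is_derive_eq h _.
by rewrite /stein_deriv (observation_update m z i s) subr0.
Qed.

Lemma continuous_stein_deriv m i z :
  continuous (fun s => stein_deriv m i (update_tuple z i s)).
Proof.
move=> s; have tf := tempered_fit X i.
rewrite /stein_deriv; under eq_fun do rewrite (observation_update m z i).
rewrite (observation_update m z i); apply: cvgB; first exact: cvg_cst.
apply: cvgM; first exact: cvg_cst.
apply: cvgM; first exact: cvg_cst.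
exact: continuous_post_cov.
Qed.

Lemma prediction_lossE bstar y :
  prediction_loss X (ewa X lambda tau y) bstar =
  n%:R^-1 * \sum_i (pm y (fit i) - (X *m bstar) i 0) ^+ 2.
Proof.
congr (_ * _); apply: eq_bigr => i _.
by rewrite mulmxBr col_subE mul_ewaE.
Qed.

(* Per coordinate, [(z - g)^2 = g^2 + z (z - 2 g)] with [g] the error of the fit,
   while [- sigma^2 + 2 sigma^2 var / (n tau)] is [- sigma^2] times the derivative
   of [z - 2 g]. *)
Lemma ewa_risk_estimatorE sigma bstar z :
  let m := X *m bstar in
  ewa_risk_estimator X sigma lambda tau (observation m z) =
  prediction_loss X (ewa X lambda tau (observation m z)) bstar +
  n%:R^-1 * \sum_i (tnth z i * stein_field m i z - sigma ^+ 2 * stein_deriv m i z).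
Proof.
move=> m; set y := observation m z.
have nR : n%:R != 0 :> R by rewrite pnatr_eq0 -lt0n.
have tR : tau != 0 by rewrite gt_eqF.
rewrite /ewa_risk_estimator post_varE prediction_lossE.
(* The constant is spread as an average over the coordinates, so that the identity can be checked
   term by term. *)
have {1}-> : sigma ^+ 2 = n%:R^-1 * \sum_(i < n) sigma ^+ 2.
  by rewrite sumr_const card_ord -[X in _ * X]mulr_natl mulKf.
have -> : 2 * sigma ^+ 2 / (n%:R ^+ 2 * tau) * \sum_i cov y (fit i) (fit i) =
  n%:R^-1 * \sum_i (2 * sigma ^+ 2 / (n%:R * tau) * cov y (fit i) (fit i)).
  by rewrite -mulr_sumr; field; rewrite nR tR.
rewrite -mulrBr -!mulrDr -sumrB -!big_split/=; congr (_ * _).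
apply: eq_bigr => i _.
rewrite col_subE mul_ewaE.
rewrite /stein_field /stein_deriv -/y -/m.
have -> : y i 0 = m i 0 + tnth z i by rewrite !mxE.
by field; rewrite nR tR.
Qed.

End ewa_risk.

Theorem mainTheorem5 (R : realType) (d : measure_display)
    (Omega : measurableType d) (P : probability Omega R) (n p : nat)
    (X : 'M[R]_(n, p)) (bstar : 'cV[R]_p) (xi : {RV P >-> n.-tuple R})
    (sigma lambda tau : R) :
  (0 < n)%N -> (0 < p)%N -> 0 < sigma ->
  gaussian_vector xi 0 (sigma ^+ 2)%:M ->
  0 < lambda -> 0 < tau ->
  let y := fun w : Omega => X *m bstar + col_of_tuple (xi w) in
  let risk_hat := fun w : Omega =>
    ewa_risk_estimator X sigma lambda tau (y w) in
  let loss := fun w : Omega =>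
    prediction_loss X (ewa X lambda tau (y w)) bstar in
  [/\ P.-integrable setT (EFin \o risk_hat),
      P.-integrable setT (EFin \o loss) &
      ('E_P[risk_hat] = 'E_P[loss])%E].
Proof.
move=> n0 _ s0 xiG l0 t0 y risk_hat loss.
set m := X *m bstar.
pose h i := stein_field X lambda tau m i.
pose D i := stein_deriv X lambda tau m i.
have th i : tempered (h i) by exact: tempered_stein_field.
have tD i : tempered (D i) by exact: tempered_stein_deriv.
pose f i (z : n.-tuple R) := tnth z i * h i z - sigma ^+ 2 * D i z.
have tf i : tempered (f i).
  apply: temperedB; last exact: temperedZ.
  by apply: temperedM => //; exact: tempered_tnth.
pose g z := n%:R^-1 * \sum_i f i z.
(* The decomposition is pointwise, so integrability of [risk_hat] follows from that of [loss] and
   [g], and unbiasedness reduces to the zero mean of [g]. *)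
have riskE w : risk_hat w = loss w + g (xi w).
  exact: ewa_risk_estimatorE.
have iloss : P.-integrable setT (EFin \o loss).
  pose l z := prediction_loss X (ewa X lambda tau (observation m z)) bstar.
  apply: (@integrable_tempered_gaussian _ _ _ _ _ xi sigma s0 xiG l).
  rewrite (_ : l = fun z => n%:R^-1 *
    \sum_i (post_mean X lambda tau (observation m z) (fit X i) - m i 0) ^+ 2); last first.
    by apply/funext => z; exact: prediction_lossE.
  apply: temperedZ; apply: tempered_sum => i; apply: temperedX.
  apply: temperedB; last exact: tempered_cst.
  by apply: tempered_post_mean => //; exact: tempered_fit.
have ig : P.-integrable setT (EFin \o (g \o xi)).
  apply: (integrable_tempered_gaussian s0 xiG).
  by apply: temperedZ; exact: tempered_sum.
have i_f i : P.-integrable setT (EFin \o (f i \o xi)).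
  exact: (integrable_tempered_gaussian s0 xiG).
have Eg : (\int[P]_w (g (xi w))%:E = 0)%E.
  transitivity ((n%:R^-1)%:E * \sum_i \int[P]_w (f i (xi w))%:E)%E.
    rewrite -(integral_sum measurableT i_f) -integralZl//; last first.
      exact: (integrable_sum measurableT _ (fun i _ => i_f i)).
    by apply: eq_integral => w _; rewrite /g EFinM sumEFin.
  rewrite big1 ?mule0// => i _.
  apply: (gaussian_stein s0 xiG (th i) (tD i)).
  - by move=> z s; exact: is_derive_stein_field.
  - by move=> z; exact: continuous_stein_deriv.
have riskf : EFin \o risk_hat = (EFin \o loss) \+ (EFin \o (g \o xi)).
  by apply/funext => w /=; rewrite riskE EFinD.
split => //.
  by rewrite riskf; exact: integrableD.
rewrite unlock -[LHS]/(\int[P]_w (EFin \o risk_hat) w)%E riskf.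
by rewrite integralD//= Eg adde0.
Qed.
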